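(* Let $S$ be a compact Hausdorff space without isolated points. If $T\colon C(S)\to C(S)$ is a weakly compact bounded linear operator, then $$\|\mathrm{Id}+T\| = 1+\|T\|.$$
   Context: Compact Hausdorff spaces are nonempty. Scalars are real: $C(S)$ is the real Banach space of continuous functions $S\to\mathbb{R}$ with the supremum norm; $\mathrm{Id}$ is the identity operator and operators carry the operator norm. A bounded linear operator is weakly compact if it maps the closed unit ball to a relatively weakly compact set. *)

(* Defs.v *)
From HB Require Import structures.
From mathcomp Require Import all_boot all_order all_algebra.
From mathcomp Require Import all_classical all_reals all_analysis.
From mathcomp Require Import lra.

Set Implicit Arguments.
Unset Strict Implicit.
Unset Printing Implicit Defensive.
Import Order.TTheory GRing.Theory Num.Theory.
Import numFieldNormedType.Exports.
Local Open Scope classical_set_scope.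
Local Open Scope ring_scope.

(** The real Banach space C(S). Compactness of S is a parameter of the type
    because the supremum norm is a norm only for bounded functions. *)
Definition contfun (R : realType) (S : topologicalType)
  (cptS : compact [set: S]) : Type := continuousType S R.

Definition contfun_fun (R : realType) (S : topologicalType)
  (cptS : compact [set: S]) (f : contfun R cptS) : S -> R := Continuous.sort f.
Coercion contfun_fun : contfun >-> Funclass.

Section contfun_theory.
Context (R : realType) (S : topologicalType) (cptS : compact [set: S]).
Local Notation CS := (contfun R cptS).
Implicit Types f g : CS.

Lemma contfun_continuous f : continuous (f : S -> R).
Proof. exact: (@cts_fun _ _ f). Qed.

Definition mk_contfun (f : S -> R) (cf : continuous f) : CS :=
  (mkcts cf : continuousType S R).

Lemma contfunP f g : (forall x, f x = g x) -> f = g.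
Proof. by move=> fg; apply/continuousEP. Qed.

HB.instance Definition _ := Choice.copy CS (continuousType S R).

Let add_cts f g : continuous (fun x => f x + g x).
Proof. by move=> x; apply: cvgD; exact: contfun_continuous. Qed.
Let opp_cts f : continuous (fun x => - f x).
Proof. by move=> x; apply: cvgN; exact: contfun_continuous. Qed.
Let zero_cts : continuous (fun _ : S => 0 : R).
Proof. by move=> x; exact: cvg_cst. Qed.
Let scale_cts (a : R) f : continuous (fun x => a * f x).
Proof. by move=> x; apply: cvgM; [exact: cvg_cst|exact: contfun_continuous]. Qed.

Let add f g := mk_contfun (@add_cts f g).
Let opp f := mk_contfun (@opp_cts f).
Let zero := mk_contfun zero_cts.
Let scale a f := mk_contfun (@scale_cts a f).

Let addA : associative add.
Proof. by move=> f g h; apply: contfunP => x; exact: addrA. Qed.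
Let addC : commutative add.
Proof. by move=> f g; apply: contfunP => x; exact: addrC. Qed.
Let add0 : left_id zero add.
Proof. by move=> f; apply: contfunP => x; exact: add0r. Qed.
Let addN : left_inverse zero opp add.
Proof. by move=> f; apply: contfunP => x; exact: addNr. Qed.
HB.instance Definition _ := GRing.isZmodule.Build CS addA addC add0 addN.

Let scaleA a b f : scale a (scale b f) = scale (a * b) f.
Proof. by apply: contfunP => x; exact: mulrA. Qed.
Let scale1 : left_id 1 scale.
Proof. by move=> f; apply: contfunP => x; exact: mul1r. Qed.
Let scaleDr : right_distributive scale +%R.
Proof. by move=> a f g; apply: contfunP => x; exact: mulrDr. Qed.
Let scaleDl f : {morph scale^~ f : a b / a + b}.
Proof. by move=> a b; apply: contfunP => x; exact: mulrDl. Qed.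
HB.instance Definition _ :=
  GRing.Zmodule_isLmodule.Build R CS scaleA scale1 scaleDr scaleDl.

Definition supnorm (f : CS) : R := sup [set `|f x| | x in [set: S]].

Lemma supnorm_has_ubound f : has_ubound [set `|f x| | x in [set: S]].
Proof.
have /compact_bounded[M [_ fM]] : compact (f @` [set: S]).
  apply: continuous_compact => //.
  by apply: continuous_subspaceT; exact: contfun_continuous.
by exists (M + 1) => _ [x _ <-]; apply: (fM (M + 1)); [rewrite ltrDl|exists x].
Qed.

Lemma supnorm_ge f x : `|f x| <= supnorm f.
Proof. by apply: ub_le_sup; [exact: supnorm_has_ubound|exists x]. Qed.

Lemma supnorm_le f (M : R) :
  0 <= M -> (forall x, `|f x| <= M) -> supnorm f <= M.
Proof.
move=> M0 fM; rewrite /supnorm.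
have [->|/set0P S0] := eqVneq [set `|f x| | x in [set: S]] set0.
  by rewrite sup0.
by apply: ge_sup => // _ [x _ <-].
Qed.

Lemma supnorm_ge0 f : 0 <= supnorm f.
Proof.
rewrite /supnorm.
have [->|/set0P[_ [x _ _]]] := eqVneq [set `|f x| | x in [set: S]] set0.
  by rewrite sup0.
exact: le_trans (supnorm_ge f x).
Qed.

Let supnormD f g : supnorm (f + g) <= supnorm f + supnorm g.
Proof.
apply: supnorm_le => [|x]; first by rewrite addr_ge0 ?supnorm_ge0.
by apply: (le_trans (ler_normD (f x) (g x))); rewrite lerD ?supnorm_ge.
Qed.

Let supnormZ (a : R) f : supnorm (a *: f) = `|a| * supnorm f.
Proof.
apply/eqP; rewrite eq_le; apply/andP; split.
  apply: supnorm_le => [|x]; first by rewrite mulr_ge0 ?supnorm_ge0.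
  by rewrite [X in X <= _](normrM a (f x)) ler_wpM2l ?supnorm_ge.
have [->|a0] := eqVneq a 0; first by rewrite normr0 mul0r supnorm_ge0.
rewrite mulrC -ler_pdivlMr ?normr_gt0//.
apply: supnorm_le => [|x]; first by rewrite divr_ge0 ?supnorm_ge0.
rewrite ler_pdivlMr ?normr_gt0// mulrC -normrM.
exact: (supnorm_ge (a *: f) x).
Qed.

Let supnorm0_eq0 f : supnorm f = 0 -> f = 0.
Proof.
move=> f0; apply: contfunP => x; apply/eqP; rewrite -normr_le0 -f0.
exact: supnorm_ge.
Qed.

HB.instance Definition _ :=
  Lmodule_isNormed.Build R CS supnormD supnormZ supnorm0_eq0.

Lemma contfun_normE f : `|f| = sup [set `|f x| | x in [set: S]].
Proof. by []. Qed.

Let completeCS (F : set_system CS) : ProperFilter F -> cauchy F -> cvg F.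
Proof.
move=> FF /cauchy_ballP Fc.
have Fx (x : S) : cvg ((fun f : CS => f x) @ F).
  apply: R_complete; apply/cauchy_ballP => e e0.
  have := Fc _ e0; rewrite !near_simpl => -[[A B] [/= FA FB] AB].
  exists ([set (f : CS) x | f in A], [set (f : CS) x | f in B]) => /=.
    by split; [apply: filterS FA | apply: filterS FB] => f ? /=; exists f.
  move=> [_ _] [/= [f Af <-] [g Bg <-]].
  have := AB (f, g) (conj Af Bg); rewrite -!ball_normE /=.
  by apply: le_lt_trans; exact: (supnorm_ge (f - g) x).
pose l x : R := lim ((fun f : CS => f x) @ F).
have Fl (e : R) : 0 < e -> \forall f \near F, forall x, `|l x - (f : CS) x| <= e.
  move=> e0; have [[A B] [/= FA FB] AB] := Fc _ e0.
  apply: filterS FB => g Bg x; rewrite distrC.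
  apply/ler_addgt0Pl => d d0.
  have /cvgrPdist_lt/(_ _ d0) FA' : (fun f : CS => f x) @ F --> l x by exact: Fx.
  have [f [Af /= fl]] := filter_ex (filterI FA FA').
  have /ltW fg : `|f x - g x| < e.
    have := AB (f, g) (conj Af Bg); rewrite -ball_normE /=.
    by apply: le_lt_trans; exact: (supnorm_ge (f - g) x).
  rewrite distrC (le_trans (ler_distD (f x) _ _))// lerD//.
  exact: ltW.
have lc : continuous l.
  move=> x; apply/cvgrPdist_le => e e0.
  have e3 : 0 < e / 3 by rewrite divr_gt0.
  have [f fl] := filter_ex (Fl _ e3).
  have /cvgrPdist_le/(_ _ e3) := @contfun_continuous f x.
  apply: filterS => t xt.
  rewrite (le_trans (ler_distD (f x) _ _))//.
  rewrite [leRHS](_ : e = e / 3 + (e / 3 + e / 3)); last by lra.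
  rewrite lerD// (le_trans (ler_distD (f t) _ _))// lerD//.
  by rewrite distrC.
apply/cvg_ex; exists (mk_contfun lc); apply/cvgrPdist_le => e e0.
apply: filterS (Fl _ e0) => f fl.
by apply: supnorm_le; [exact: ltW|exact: fl].
Qed.

HB.instance Definition _ := Uniform_isComplete.Build CS completeCS.

End contfun_theory.

(** The least upper bound exists, so this is the operator norm, only for
    bounded operators: [sup] is 0 on sets that are not bounded above. *)
Definition opnorm (R : realType) (V W : normedModType R) (f : V -> W) : R :=
  sup [set `|f x| | x in [set x | `|x| <= 1]].

Section weak_topology.
Context (R : realType) (V : normedModType R).

Definition topological_dual : Type := {phi : {scalar V} | continuous phi}.

(** The topology sigma(V, V^* ), as an alias of V distinct from its norm
    topology. *)
Definition weak_topology : Type :=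
  sup_topology (fun phi : topological_dual =>
    Topological.on (initial_topology (sval phi : V -> R))).

HB.instance Definition _ := Topological.on weak_topology.

End weak_topology.

Definition weakly_compact_operator (R : realType) (V W : normedModType R)
  (f : V -> W) : Prop :=
  precompact (f @` [set x | `|x| <= 1] : set (weak_topology W)).

(* Main.v *)
Require Import Defs.
From HB Require Import structures.
From mathcomp Require Import all_boot all_order all_algebra.
From mathcomp Require Import all_classical all_reals all_analysis.
From mathcomp Require Import lra.
Import Order.TTheory GRing.Theory Num.Theory.
Import numFieldNormedType.Exports.
Local Open Scope classical_set_scope.
Local Open Scope ring_scope.

Set Implicit Arguments.
Unset Strict Implicit.
Unset Printing Implicit Defensive.

(** The inequality [<=] is the triangle inequality. For [>=], fix e > 0, pick f
    in the unit ball with Tf > ||T|| - e/2 on a nonempty open set U (change the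
    sign of f if necessary), and try to raise f to the value 1 at some point s
    of U without lowering Tf(s) by more than e/2. Given a bump h at s, that is
    0 <= h <= 1 and h(s) = 1, put g = f + h(1 - f) = (1 - h)f + h. It stays in
    the unit ball and g(s) = 1, so (Id + T)g takes at s the value
    1 + Tf(s) + T(h(1 - f))(s). It remains to choose s and h such that
    T(h(1 - f))(s) >= -e/2; with v = (1 - f)/2, a function in the unit ball,
    this is [bump_with_small_loss].

    Suppose that T(hv)(s) < -e for every s in U and every bump h at s
    supported in U. As h shrinks to s, the functions T(hv) stay in a weakly
    compact set, hence have a cluster point u_s that is again a _continuous_
    function ([cluster_of_bumps]). This is the role of weak compactness; only
    the values of u_s at single points will be approximated. Then
    u_s(s) <= -e, so u_s < -e/2 near s, and therefore T(hv)(x) can be made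
    less than -e/4 for any prescribed x close to s by a bump h whose support
    may be as small as one likes, in particular disjoint from x. Since there
    are no isolated points, such points x different from s exist, and the
    construction can be repeated around them: [stack_bumps] produces
    disjointly supported bumps h_1, ..., h_n and one point x such that each
    T(h_i v)(x) is at most -e/4. The sum h of the h_i still takes values in
    [0, 1], so T(hv)(x) <= -ne/4 contradicts the boundedness of T for large n.

    This replaces the usual representation of T by a kernel of measures mu_s:
    u_s(x) plays the part of v(s) mu_x({s}). *)

(** * Cut-off functions and point evaluations on C(S) *)

Section continuous_functions.
Context (R : realType) (S : topologicalType) (cptS : compact [set: S]).
Local Notation CS := (contfun R cptS).
Implicit Types f g h v : CS.

Lemma contfun_mul_continuous f g : continuous (fun x => f x * g x).
Proof. by move=> x; apply: cvgM; exact: contfun_continuous. Qed.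

Definition contfun_mul f g : CS := mk_contfun cptS (@contfun_mul_continuous f g).

Lemma contfun_mul0l v : contfun_mul 0 v = 0.
Proof. by apply: contfunP => x; exact: mul0r. Qed.

Lemma contfun_mulDl f g v :
  contfun_mul (f + g) v = contfun_mul f v + contfun_mul g v.
Proof. by apply: contfunP => x; exact: mulrDl. Qed.

Definition contfun1 : CS := mk_contfun cptS (@cst_continuous S R 1).

Lemma norm_ge_eval f x : `|f x| <= `|f|.
Proof. exact: supnorm_ge. Qed.

(** No value is prescribed anywhere inside W, so that 0 and disjoint sums are
    cut-offs too; a bump at s is a cut-off h with the extra equation h s = 1. *)
Definition cutoff (W : set S) (h : CS) : Prop :=
  (forall x, 0 <= h x <= 1) /\ (forall x, ~ W x -> h x = 0).

Lemma cutoff0 W : cutoff W 0.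
Proof. by split=> x //; rewrite (_ : (0 : CS) x = 0)// lexx ler01. Qed.

Lemma sub_cutoff W V h : W `<=` V -> cutoff W h -> cutoff V h.
Proof. by move=> WV [h01 h0]; split=> // x Vx; apply: h0 => /WV. Qed.

Lemma cutoffD W V h g : W `&` V = set0 -> cutoff W h -> cutoff V g ->
  cutoff (W `|` V) (h + g).
Proof.
move=> WV0 [h01 h0] [g01 g0].
have E x : (h + g : CS) x = h x + g x by [].
split=> x; rewrite E.
  have [Wx|nWx] := pselect (W x).
    rewrite (g0 x) ?addr0// => Vx.
    by have : (W `&` V) x by []; rewrite WV0.
  by rewrite (h0 x)// add0r.
by move=> /not_orP[nW nV]; rewrite h0// g0// addr0.
Qed.

Lemma norm_cutoff_mul W h v : cutoff W h -> `|v| <= 1 ->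
  `|contfun_mul h v| <= 1.
Proof.
move=> [h01 _] v1; apply: supnorm_le => // x.
have /andP[h0 h1] := h01 x.
rewrite [X in `|X|](_ : _ = h x * v x)// normrM ger0_norm//.
rewrite -[leRHS]mulr1 ler_pM//.
exact: le_trans (norm_ge_eval _ _) v1.
Qed.

(** Urysohn's lemma, for the closed sets [set s] and ~` W. *)
Lemma bump_exists (W : set S) (s : S) : hausdorff_space S -> open W -> W s ->
  exists2 h : CS, cutoff W h & h s = 1.
Proof.
move=> hausS oW Ws.
have := @urysohn_ext_itv S R (compact_normal hausS cptS) (~` W) [set s] 0 1.
case.
- exact: open_closedC.
- exact/accessible_closed_set1/hausdorff_accessible.
- by rewrite -subset0 => x [nWx /= xs]; apply: nWx; rewrite xs.
- exact: ltr01.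
move=> h [ch h0 h1 h01].
exists (mk_contfun cptS ch); last by apply: h1; exists s.
split=> x; last by move=> nWx; apply: h0; exists x.
by have := h01 (h x) (ex_intro2 _ _ x I erefl); rewrite /= in_itv.
Qed.

(** The coercion of C(S) to functions, under a name to which a linear structure
    can be attached. *)
Definition eval_at (x : S) (f : CS) : R := f x.

Lemma eval_at_scalar x : scalar (eval_at x).
Proof. by move=> a f g. Qed.
HB.instance Definition _ x :=
  GRing.isLinear.Build R CS R _ (eval_at x) (eval_at_scalar x).

Lemma eval_at_continuous x : continuous (eval_at x).
Proof.
move=> f; have Ff := nbhs_filter f; apply/cvgrPdist_lt => e e0.
apply: filterS (nbhsx_ballx f e e0) => g; rewrite -ball_normE /=.
by apply: le_lt_trans; exact: (norm_ge_eval (f - g) x).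
Qed.

(** The weak topology is finer than that of pointwise convergence, because point
    evaluations are bounded functionals. *)
Lemma weak_nbhs_eval (u : CS) (x : S) (d : R) : 0 < d ->
  nbhs (u : weak_topology CS) [set w : CS | `|w x - u x| < d].
Proof.
move=> d0.
pose phi : topological_dual CS :=
  exist _ (eval_at x : {scalar CS}) (@eval_at_continuous x).
have /cvg_sup/(_ phi) : nbhs (u : weak_topology CS) --> (u : weak_topology CS).
  exact: cvg_id.
apply.
have /(_ u) := @initial_continuous CS R (sval phi : CS -> R).
move=> /cvgrPdist_lt/(_ _ d0); apply: filterS => w /=.
by rewrite distrC.
Qed.

End continuous_functions.

(** * Images of shrinking bumps under a weakly compact operator *)

Section operators_on_continuous_functions.
Context (R : realType) (S : topologicalType) (cptS : compact [set: S]).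
Local Notation CS := (contfun R cptS).
Hypothesis hausS : hausdorff_space S.
Context (T : {linear CS -> CS}).

(** The sets of all T (h v), with h a bump at s supported in a given open
    neighbourhood W, form a filter base as W shrinks to s; u is a weak cluster
    point of it. The point of the statement is that u does not depend on W and
    x, and is continuous, although the bumps hv themselves converge pointwise
    to a function that is in general discontinuous. *)
Lemma cluster_of_bumps (v : CS) (s : S) : weakly_compact_operator T ->
  `|v| <= 1 ->
  exists u : CS, forall (W : set S) (x : S) (d : R), open W -> W s -> 0 < d ->
    exists h : CS, [/\ cutoff W h, h s = 1 & `|T (contfun_mul h v) x - u x| < d].
Proof.
move=> [K TK [cK _]] v1.
pose B (W : set S) : set CS :=
  [set T (contfun_mul h v) | h in [set h : CS | cutoff W h /\ h s = 1]].
pose F : set_system (weak_topology CS) := filter_from (open_nbhs s) B.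
have FF : ProperFilter F.
  apply: filter_from_proper.
    apply: filter_from_filter.
      by exists setT; split=> //; exact: openT.
    move=> W V oW oV; exists (W `&` V).
      by case: oW oV => oW Ws [oV Vs]; split => //; exact: openI.
    move=> _ [h [hWV hs] <-]; split; exists h => //; split=> //.
      by apply: sub_cutoff hWV => ? [].
    by apply: sub_cutoff hWV => ? [].
  move=> W [oW Ws]; have [h hW hs] := bump_exists R cptS hausS oW Ws.
  by exists (T (contfun_mul h v)), h.
have FK : F K.
  exists setT; first by split=> //; exact: openT.
  move=> _ [h [hT _] <-]; apply: TK; exists (contfun_mul h v) => //=.
  exact: norm_cutoff_mul hT v1.
have [u [_ Fu]] := cK F FF FK.
exists u => W x d oW Ws d0.
have FW : F (B W) by exists W.
have [_ [[h [hW hs] <-] /= hd]] := Fu _ _ FW (weak_nbhs_eval u x d0).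
by exists h.
Qed.

Hypothesis isoS : isolated [set: S] = set0.

Lemma open_has_other_point (G : set S) (s : S) : open G -> G s ->
  exists2 t, G t & t != s.
Proof.
move=> oG Gs; apply: contrapT => nt.
have : isolated [set: S] s.
  split; first by rewrite inE.
  exists G; first exact: open_nbhs_nbhs.
  rewrite setIT; apply/seteqP; split=> [t Gt /=|t ->//].
  by apply: contrapT => /eqP ts; apply: nt; exists t.
by rewrite isoS.
Qed.

(** Induction on n. The new bump h sits at a point s of G, but the point x at
    which all values are compared comes from the induction hypothesis, so it
    is known only after s. Hence the order of choices: first s and its cluster
    function u, then a neighbourhood of another point t on which u < - e / 2
    and which is separated from s, then x and h' inside that neighbourhood, and
    only at the end the bump h, made to approximate u at x. *)
Lemma stack_bumps (v : CS) (U : set S) (e : R) :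
  weakly_compact_operator T -> `|v| <= 1 -> 0 < e ->
  (forall s (h : CS), U s -> cutoff U h -> h s = 1 ->
     T (contfun_mul h v) s < - e) ->
  forall (n : nat) (G : set S), open G -> G !=set0 -> G `<=` U ->
    exists x (h : CS),
      [/\ G x, cutoff G h & T (contfun_mul h v) x <= - (e / 4) *+ n].
Proof.
move=> wT v1 e0 bad; elim=> [|n IHn] G oG [s Gs] GU.
  exists s, 0; split=> //; first exact: cutoff0.
  by rewrite contfun_mul0l linear0 mulr0n.
have [u uP] := cluster_of_bumps s wT v1.
have e8 : 0 < e / 8 by lra.
(* Some bump at s has T (h v) s within e / 8 of u s. *)
have us : u s < - (e / 2).
  have [h [hG hs hu]] := uP G s (e / 8) oG Gs e8.
  have := bad s h (GU _ Gs) (sub_cutoff GU hG) hs.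
  by move: hu; rewrite ltr_distl => /andP[]; lra.
pose V := [set x | u x < - (e / 2)].
have oV : open V.
  have -> : V = (u : S -> R) @^-1` [set y | y < - (e / 2)] by [].
  by apply: open_comp => [x _|]; [exact: contfun_continuous|exact: open_lt].
(* This is the only use of the absence of isolated points. *)
have [t [Gt Vt] ts] := open_has_other_point (openI oG oV) (conj Gs us).
move: (hausS); rewrite open_hausdorff => /(_ _ _ ts)[[A B] /= [/set_mem At /set_mem Bs]].
move=> [oA oB /eqP AB0].
have [x [h' [[[Gx Vx] Ax] h'G h'x]]] : exists x (h : CS),
  [/\ (G `&` V `&` A) x, cutoff (G `&` V `&` A) h &
      T (contfun_mul h v) x <= - (e / 4) *+ n].
  apply: IHn; first by apply: openI => //; exact: openI.
    by exists t.
  by move=> y [[/GU]].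
have [h [hB hs hx]] := uP (G `&` B) x (e / 8) (openI oG oB) (conj Gs Bs) e8.
exists x, (h + h'); split=> //.
  apply: sub_cutoff (cutoffD _ hB h'G); first by move=> y [[]|[[]]].
  rewrite -subset0 => y [[_ By] [_ Ay]].
  by have : (A `&` B) y by []; rewrite AB0.
have -> : T (contfun_mul (h + h') v) x =
    T (contfun_mul h v) x + T (contfun_mul h' v) x.
  by rewrite contfun_mulDl linearD.
rewrite mulrS lerD//.
move: hx Vx; rewrite ltr_distl /V /= => /andP[]; lra.
Qed.

(** If every bump in U lost more than e, [stack_bumps] would give
    arbitrarily negative values of T on the unit ball. *)
Lemma bump_with_small_loss (v : CS) (U : set S) (e : R) :
  bounded_fun_norm T -> weakly_compact_operator T ->
  `|v| <= 1 -> 0 < e -> open U -> U !=set0 ->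
  exists s (h : CS), [/\ U s, cutoff U h, h s = 1 & - e <= T (contfun_mul h v) s].
Proof.
move=> bT wT v1 e0 oU U0; apply: contrapT => none.
have bad s (h : CS) : U s -> cutoff U h -> h s = 1 ->
    T (contfun_mul h v) s < - e.
  move=> Us hU hs; rewrite ltNge; apply/negP => le_e.
  by apply: none; exists s, h.
have [M TM] := bT 1.
have [n Mn] : exists n : nat, M < (e / 4) *+ n.
  exists (Num.truncn (M / (e / 4))).+1.
  rewrite -mulr_natr -ltr_pdivrMl; last by lra.
  rewrite mulrC; exact: truncnS_gt.
have [x [h [_ hU]]] := stack_bumps wT v1 e0 bad n oU U0 (@subset_refl _ U).
have := le_trans (norm_ge_eval _ x) (TM _ (norm_cutoff_mul hU v1)).
rewrite ler_norml mulNrn => /andP[lb _] /(le_trans lb).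
by rewrite lerN2 leNgt Mn.
Qed.

End operators_on_continuous_functions.

(** * The operator norm as a supremum over the unit ball *)

Section operator_norm.
Context (R : realType) (V W : normedModType R).

Lemma opnorm_ge (f : V -> W) (x : V) :
  bounded_fun_norm f -> `|x| <= 1 -> `|f x| <= opnorm f.
Proof.
move=> bf x1; apply: ub_le_sup; last by exists x.
by have [M fM] := bf 1; exists M => _ [y /fM ? <-].
Qed.

Lemma opnorm_le (f : V -> W) (M : R) :
  (forall x, `|x| <= 1 -> `|f x| <= M) -> opnorm f <= M.
Proof.
move=> fM; apply: ge_sup => [|_ [x /fM ? <-]//].
by exists `|f 0|, 0 => //=; rewrite normr0 ler01.
Qed.

Lemma opnorm_adherent (f : V -> W) (e : R) : bounded_fun_norm f -> 0 < e ->
  exists2 x, `|x| <= 1 & opnorm f - e < `|f x|.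
Proof.
move=> bf e0.
have [|_ [x x1 <-] ltx] :=
    @sup_adherent R [set `|f x| | x in [set x | `|x| <= 1]] e e0.
  split; first by exists `|f 0|, 0 => //=; rewrite normr0 ler01.
  by have [M fM] := bf 1; exists M => _ [y /fM ? <-].
by exists x.
Qed.

End operator_norm.

(** * The Daugavet equation *)

Unset Implicit Arguments.

Theorem theorem5 (R : realType) (S : topologicalType)
  (cptS : compact [set: S]) (hausS : hausdorff_space S)
  (neS : [set: S] !=set0) (isoS : isolated [set: S] = set0)
  (T : {linear contfun R cptS -> contfun R cptS})
  (bT : bounded_fun_norm T) (wT : weakly_compact_operator T) :
  opnorm (idfun \+ T) = 1 + opnorm T.
Proof.
have leT f : `|f| <= 1 -> `|(idfun \+ T) f| <= 1 + opnorm T.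
  move=> f1; apply: le_trans (ler_normD _ _) _.
  by rewrite lerD// opnorm_ge.
have bIT : bounded_fun_norm (idfun \+ T).
  move=> r; have [M TM] := bT r; exists (r + M) => f fr.
  by apply: le_trans (ler_normD _ _) _; rewrite lerD// TM.
apply/eqP; rewrite eq_le opnorm_le//=.
apply/ler_addgt0Pl => e e0.
have e4 : 0 < e / 4 by lra.
(* The norms of T and of T f are each approximated up to e / 4; passing to - f
   if necessary removes the absolute value. *)
have [f [f1 [s0 fs0]]] : exists f : contfun R cptS, `|f| <= 1 /\
    exists s, opnorm T - e / 2 < T f s.
  have [f f1 Tf] := opnorm_adherent bT e4.
  have [_ [s _ <-] fs] : exists2 y, [set `|T f x| | x in [set: S]] y &
      `|T f| - e / 4 < y.
    apply: sup_adherent => //; split; last exact: supnorm_has_ubound.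
    by case: neS => s _; exists `|T f s|, s.
  have [s0|s0] := lerP 0 (T f s).
    exists f; split=> //; exists s.
    by move: fs; rewrite ger0_norm//; lra.
  exists (- f); split; first by rewrite normrN.
  exists s; have -> : T (- f) s = - T f s by rewrite linearN.
  by move: fs; rewrite ltr0_norm//; lra.
pose U := [set x | opnorm T - e / 2 < T f x].
have oU : open U.
  have -> : U = (T f : S -> R) @^-1` [set y | opnorm T - e / 2 < y] by [].
  by apply: open_comp => [x _|]; [exact: contfun_continuous|exact: open_gt].
have f11 x : -1 <= f x <= 1.
  by rewrite -ler_norml (le_trans (norm_ge_eval f x)).
(* The factor 1/2 brings 1 - f into the unit ball; it is undone in g. *)
pose v : contfun R cptS := 2^-1 *: (contfun1 R cptS - f).
have vE x : v x = 2^-1 * (1 - f x) by [].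
have v1 : `|v| <= 1.
  apply: supnorm_le => // x; rewrite vE.
  by have := f11 x; rewrite ler_norml => /andP[? ?]; apply/andP; split; lra.
have [s [h [Us [h01 hU] hs Ths]]] :=
  bump_with_small_loss hausS isoS bT wT v1 e4 oU (ex_intro _ s0 fs0).
(* Equivalently g = (1 - h) f + h, a pointwise convex combination of f and 1. *)
pose g : contfun R cptS := f + 2 *: contfun_mul h v.
have gE x : g x = f x + 2 * (h x * (2^-1 * (1 - f x))) by [].
have g1 : `|g| <= 1.
  apply: supnorm_le => // x; rewrite gE.
  have := f11 x; have := h01 x; rewrite ler_norml => /andP[? ?] /andP[? ?].
  by apply/andP; split; nra.
have TgE : T g s = T f s + 2 * T (contfun_mul h v) s.
  by rewrite linearD linearZ.
have gs : (idfun \+ T) g s = 1 + T g s.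
  have -> : (idfun \+ T) g s = g s + T g s by [].
  by rewrite gE hs; congr (_ + _); lra.
have : 1 + T g s <= opnorm (idfun \+ T).
  rewrite -gs; apply: le_trans (ler_norm _) _.
  exact: le_trans (norm_ge_eval _ _) (opnorm_ge bIT g1).
by move: Us; rewrite TgE /U /=; lra.
Qed.
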